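(* Let $\Omega \subset \mathbb R^d$ be a nonempty, open, bounded, connected set whose boundary $\partial\Omega$ is a compact $\mathbf C^{1,1}$ submanifold of $\mathbb R^d$ of dimension $d-1$, let $\Gamma \subset \bar\Omega$ be nonempty and closed, and let $k: \mathbb R_+ \times \bar\Omega \to \mathbb R_+$ be continuous with values in $[K_{\min}, K_{\max}]$ for some positive constants $K_{\min}, K_{\max}$ and such that $|k(t,x_1) - k(t,x_2)| \le L|x_1 - x_2|$ for all $t \in \mathbb R_+$, $x_1, x_2 \in \bar\Omega$, for some $L > 0$. Let $\varphi$ be the value function of the optimal control problem $\mathrm{OCP}(k)$. Then $\varphi$ satisfies $\nabla\varphi(t,x) \cdot \mathbf n(x) \ge 0$ in the viscosity supersolution sense for every $(t,x) \in \mathbb R_+ \times (\partial\Omega \setminus \Gamma)$.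
   Context: $\mathbb R_+ = [0,\infty)$, $\bar B$ is the closed unit ball of $\mathbb R^d$, and $\mathbf n(x)$ is the outward unit normal vector to $\bar\Omega$ at $x \in \partial\Omega$; $\nabla$ is the gradient in the space variable. $\mathrm{Adm}(k)$ is the set of Lipschitz continuous $\gamma: \mathbb R_+ \to \bar\Omega$ for which there is a measurable $u: \mathbb R_+ \to \bar B$ with $\dot\gamma(t) = k(t, \gamma(t)) u(t)$ for a.e. $t \ge 0$. For a Lipschitz curve $\gamma$ and $t_0 \ge 0$, $\tau(t_0, \gamma) = \inf\{t \ge 0 : \gamma(t + t_0) \in \Gamma\}$ ($+\infty$ if there is no such $t$). The value function of $\mathrm{OCP}(k)$ is $\varphi(t_0, x_0) = \inf\{\tau(t_0, \gamma) : \gamma \in \mathrm{Adm}(k),\ \gamma(t_0) = x_0\}$, $(t_0,x_0) \in \mathbb R_+ \times \bar\Omega$. Viscosity supersolution sense at $(t_0, x_0)$ means: for every neighborhood $V$ of $(t_0, x_0)$ in $\mathbb R_+ \times \bar\Omega$ and every $\mathbf C^1$ function $\xi: V \to \mathbb R$ such that $\xi(t_0, x_0) = \varphi(t_0, x_0)$ and $\xi \le \varphi$ on $V$, one has $\nabla\xi(t_0, x_0) \cdot \mathbf n(x_0) \ge 0$. *)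

(* Defs.v *)
From mathcomp Require Import all_boot all_order all_algebra.
From mathcomp Require Import all_classical all_reals all_analysis.

Set Implicit Arguments.
Unset Strict Implicit.
Unset Printing Implicit Defensive.

Import Order.TTheory GRing.Theory Num.Theory.
Import numFieldNormedType.Exports.

Local Open Scope classical_set_scope.
Local Open Scope ring_scope.

(* MathComp-Analysis equips 'rV[R]_d with the sup norm. Wherever a constant is
   quantitatively meaningful (speed bound, unit vectors), the Euclidean norm
   [enorm] is used; the library norm is only used for topology,
   differentiability, boundedness and the existence of Lipschitz constants,
   where the choice of norm on R^d is irrelevant. *)
Definition dotp (R : realType) (d : nat) (u v : 'rV[R]_d) : R :=
  \sum_(i < d) u 0 i * v 0 i.

Definition enorm (R : realType) (d : nat) (v : 'rV[R]_d) : R :=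
  Num.sqrt (dotp v v).

Definition boundary (T : topologicalType) (A : set T) : set T :=
  closure A `\` interior A.

Definition C1_on (R : realType) (V W : normedModType R)
    (U : set V) (f : V -> W) : Prop :=
  (forall x, U x -> differentiable f x) /\
  (* for finite-dimensional V, pointwise continuity of x |-> 'd f x is the same
     as continuity in operator norm *)
  (forall v, {within U, continuous (fun x => 'd f x v)}).

Definition C11_on (R : realType) (V W : normedModType R)
    (U : set V) (f : V -> W) : Prop :=
  (forall x, U x -> differentiable f x) /\
  exists M : R, forall x y, U x -> U y ->
    forall v, `|'d f x v - 'd f y v| <= M * `|x - y| * `|v|.

Definition C11_diffeo (R : realType) (d : nat)
    (U W : set 'rV[R]_d) (Phi : 'rV[R]_d -> 'rV[R]_d) : Prop :=
  Phi @` U = W /\ C11_on U Phi /\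
  exists Psi : 'rV[R]_d -> 'rV[R]_d,
    C11_on W Psi /\ (forall x, U x -> Psi (Phi x) = x).

Definition C11_submanifold (R : realType) (d m : nat)
    (M : set 'rV[R]_d) : Prop :=
  forall x, M x -> exists (U W : set 'rV[R]_d) (Phi : 'rV[R]_d -> 'rV[R]_d),
    [/\ open U, U x, open W, C11_diffeo U W Phi &
        Phi @` (U `&` M) =
        W `&` [set w | forall i : 'I_d, (m <= i)%N -> w 0 i = 0]].

Definition tangent_vector (R : realType) (d : nat)
    (M : set 'rV[R]_d) (x v : 'rV[R]_d) : Prop :=
  exists c : R -> 'rV[R]_d,
    [/\ c 0 = x, (\forall s \near (0 : R), M (c s)) & is_derive (0 : R) (1 : R) c v].

Definition outward_unit_normal (R : realType) (d : nat)
    (Omega : set 'rV[R]_d) (x nu : 'rV[R]_d) : Prop :=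
  [/\ enorm nu = 1,
      (forall v, tangent_vector (boundary Omega) x v -> dotp nu v = 0) &
      \forall s \near (0 : R)^'+, ~ closure Omega (x + s *: nu)].

(* Functions on R_+ are total functions on R of which only the values at
   arguments >= 0 matter. Measurability of u is Borel measurability, stated
   componentwise. *)
Definition Adm (R : realType) (d : nat) (Omega : set 'rV[R]_d)
    (k : R -> 'rV[R]_d -> R) (gamma : R -> 'rV[R]_d) : Prop :=
  [/\ (forall t, 0 <= t -> closure Omega (gamma t)),
      [lipschitz gamma t | t in [set t : R | 0 <= t]] &
      exists u : R -> 'rV[R]_d,
        [/\ (forall i : 'I_d,
               measurable_fun [set t : R | 0 <= t] (fun t => u t 0 i)),
            (forall t, 0 <= t -> enorm (u t) <= 1) &
            {ae (@lebesgue_measure R), forall t : R, 0 <= t ->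
               is_derive t (1 : R) gamma (k t (gamma t) *: u t)}]].

Definition tau (R : realType) (d : nat) (Gamma : set 'rV[R]_d)
    (t0 : R) (gamma : R -> 'rV[R]_d) : \bar R :=
  ereal_inf [set t%:E | t in [set t : R | 0 <= t /\ Gamma (gamma (t + t0))]].

Definition value_function (R : realType) (d : nat)
    (Omega Gamma : set 'rV[R]_d) (k : R -> 'rV[R]_d -> R)
    (t0 : R) (x0 : 'rV[R]_d) : \bar R :=
  ereal_inf [set tau Gamma t0 gamma | gamma in
    [set gamma | Adm Omega k gamma /\ gamma t0 = x0]].

Definition grad_x (R : realType) (d : nat) (xi : R * 'rV[R]_d -> R)
    (t : R) (x : 'rV[R]_d) : 'rV[R]_d :=
  \row_(i < d) 'D_(delta_mx 0 i) (fun y => xi (t, y)) x.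

Definition space_time (R : realType) (d : nat) (Omega : set 'rV[R]_d) :
    set (R * 'rV[R]_d) :=
  [set z | 0 <= z.1 /\ closure Omega z.2].

(* [grad phi . n >= 0] in the viscosity supersolution sense at (t0, x0), with
   n = n(x0). A C^1 function on the (not necessarily open) set V is the
   restriction to V of a C^1 function xi on some open set W containing V. *)
Definition visc_super_normal_derivative_ge0 (R : realType) (d : nat)
    (Omega : set 'rV[R]_d) (phi : R -> 'rV[R]_d -> \bar R)
    (t0 : R) (x0 n : 'rV[R]_d) : Prop :=
  forall (V W : set (R * 'rV[R]_d)) (xi : R * 'rV[R]_d -> R),
    V `<=` space_time Omega ->
    within (space_time Omega) (nbhs (t0, x0)) V ->
    open W -> V `<=` W -> C1_on W xi ->
    (xi (t0, x0))%:E = phi t0 x0 ->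
    (forall z, V z -> ((xi z)%:E <= phi z.1 z.2)%E) ->
    0 <= dotp (grad_x xi t0 x0) n.

(* Main.v *)
Require Import Defs.
From mathcomp Require Import all_boot all_order all_algebra.
From mathcomp Require Import all_classical all_reals all_analysis.
From mathcomp Require Import measurable_realfun.
From mathcomp Require Import ring lra.
Set Implicit Arguments.
Unset Strict Implicit.
Unset Printing Implicit Defensive.
Import Order.TTheory GRing.Theory Num.Theory.
Import numFieldNormedType.Exports.
Local Open Scope classical_set_scope.
Local Open Scope ring_scope.

(** Write [phi] for the value function and [p] for the spatial gradient at
[(t0, x0)] of a test function [xi] touching [phi] from below there. If
[dotp p n < 0], then [xi] grows at a definite rate when one leaves [x0] along
[- n], so [phi] has to grow at least as fast. The proof shows that it does not:
starting from [x0 - eps *: n] instead of [x0] costs no time, up to moving the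
starting point by a small fraction of [eps].

The reason is that the domain is flat at small scales. A trajectory which starts
at [x0] and stays in the closed domain covers during a time [T] a displacement
[D] with [dotp n D <= o(T)]. Seen from the point [x0 - eps *: n], the place it
reaches is therefore at distance [sqrt (|D|^2 + eps^2 + o(T) eps)] at most,
hence farther away by an excess of order [eps^2 / T] only. With [T = M * eps] this
is of order [eps / M], and it disappears if one starts from
[x0 - eps *: n + th *: D] with [th] of order [1 / M ^ 2], a point at distance of
order [eps / M] from [x0 - eps *: n]. From there a straight segment run at
constant speed meets the trajectory exactly at time [t0 + T], and the trajectory
can be followed from then on. Arriving exactly on time avoids comparing the speeds
at two different times, for which [k], merely continuous in time, gives no rate;
at the scale [T = M * eps] the variations of [k] cost [o(eps)].
Inserting the new starting points in [xi <= phi] and letting [eps] tend to [0]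
and [M] to infinity gives [dotp p n >= 0].

Three ingredients carry the argument. [inward_segment] and [dotp_normal_le]
describe the domain near [x0]; they rest on a function [psi] with strict
derivative [dotp n] at [x0] such that the closed domain is [psi <= 0] near [x0]
([C11_domain_sublevel]). [Adm_speed] bounds displacements by time, and needs a
mean value inequality for Lipschitz functions differentiable almost everywhere
([lipschitz_ae_derive_le]). [Adm_detour] checks that the modified trajectory is
admissible. They are combined in [inward_detour]. *)

(** * Euclidean structure on row vectors *)

Section Euclidean.
Context (R : realType) (d : nat).
Implicit Types (u v w : 'rV[R]_d) (c : R).

Lemma dotpC u v : dotp u v = dotp v u.
Proof. by apply: eq_bigr => i _; rewrite mulrC. Qed.

Lemma dotpDl u v w : dotp (u + v) w = dotp u w + dotp v w.
Proof.
by rewrite /dotp -big_split; apply: eq_bigr => i _; rewrite mxE mulrDl.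
Qed.

Lemma dotpZl c u v : dotp (c *: u) v = c * dotp u v.
Proof. by rewrite /dotp mulr_sumr; apply: eq_bigr => i _; rewrite mxE mulrA. Qed.

Lemma dotpDr u v w : dotp u (v + w) = dotp u v + dotp u w.
Proof. by rewrite dotpC dotpDl !(dotpC u). Qed.

Lemma dotpZr c u v : dotp u (c *: v) = c * dotp u v.
Proof. by rewrite dotpC dotpZl dotpC. Qed.

Lemma dotpNr u v : dotp u (- v) = - dotp u v.
Proof. by rewrite -scaleN1r dotpZr mulN1r. Qed.

Lemma dotpBr u v w : dotp u (v - w) = dotp u v - dotp u w.
Proof. by rewrite dotpDr dotpNr. Qed.

Lemma dotpBl u v w : dotp (u - v) w = dotp u w - dotp v w.
Proof. by rewrite dotpC dotpBr !(dotpC w). Qed.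

Lemma dotp0r u : dotp u 0 = 0.
Proof. by rewrite -(scale0r 0) dotpZr mul0r. Qed.

Lemma dotpvv_ge0 v : 0 <= dotp v v.
Proof. by apply: sumr_ge0 => i _; rewrite -expr2 sqr_ge0. Qed.

Lemma enorm_ge0 v : 0 <= enorm v.
Proof. exact: sqrtr_ge0. Qed.

Lemma enorm_sqr v : enorm v ^+ 2 = dotp v v.
Proof. by rewrite sqr_sqrtr // dotpvv_ge0. Qed.

Lemma enormZ c v : enorm (c *: v) = `|c| * enorm v.
Proof.
by rewrite /enorm dotpZl dotpZr mulrA -expr2 sqrtrM ?sqr_ge0 // sqrtr_sqr.
Qed.

Lemma cauchy_schwarz u v : dotp u v <= enorm u * enorm v.
Proof.
have := enorm_sqr u; have := enorm_sqr v.
have := enorm_ge0 u; have := enorm_ge0 v.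
set p := enorm u; set q := enorm v => q0 p0 qE pE.
have h : 0 <= dotp (q *: u - p *: v) (q *: u - p *: v) by exact: dotpvv_ge0.
move: h; rewrite dotpBr !dotpBl !dotpZl !dotpZr -pE -qE (dotpC v u) => h.
have [p1|p1] := eqVneq p 0.
  suff -> : u = 0 by rewrite dotpC dotp0r mulr_ge0.
  move: pE; rewrite p1 expr0n /= => /esym/eqP.
  rewrite psumr_eq0 => [/allP u0|i _]; last by rewrite -expr2 sqr_ge0.
  apply/rowP => i; rewrite mxE; apply/eqP.
  by move: (u0 i (mem_index_enum _)); rewrite mulf_eq0 orbb.
have [q1|q1] := eqVneq q 0.
  suff -> : v = 0 by rewrite dotp0r mulr_ge0.
  move: qE; rewrite q1 expr0n /= => /esym/eqP.
  rewrite psumr_eq0 => [/allP u0|i _]; last by rewrite -expr2 sqr_ge0.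
  apply/rowP => i; rewrite mxE; apply/eqP.
  by move: (u0 i (mem_index_enum _)); rewrite mulf_eq0 orbb.
have pq : 0 < p * q by rewrite mulr_gt0 // lt_neqAle eq_sym ?p1 ?q1.
by rewrite -(ler_pM2l pq); nra.
Qed.

Lemma normr_dotp_le u v : `|dotp u v| <= enorm u * enorm v.
Proof.
rewrite ler_norml cauchy_schwarz andbT lerNl -dotpNr.
by rewrite (le_trans (cauchy_schwarz _ _))// -[- v]scaleN1r enormZ normrN1 mul1r.
Qed.

Lemma normr_coord_le v i : `|v 0 i| <= `|v|.
Proof.
rewrite [leRHS]/Num.norm /= mx_normrE.
exact: (le_bigmax _ (fun j : 'I_1 * 'I_d => `|v j.1 j.2|) (0, i)).
Qed.

Lemma normr_le_enorm v : `|v| <= enorm v.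
Proof.
rewrite /Num.norm /= mx_normrE; apply: bigmax_le => [|[j i] _ /=]; first exact: enorm_ge0.
rewrite ord1 -sqrtr_sqr ler_wsqrtr // /dotp (bigD1 i) //= expr2 lerDl.
by apply: sumr_ge0 => l _; rewrite -expr2 sqr_ge0.
Qed.

Lemma enorm_le_normr v : enorm v <= d.+1%:R * `|v|.
Proof.
rewrite -[leRHS]ger0_norm ?mulr_ge0 // -sqrtr_sqr ler_wsqrtr //.
apply: (@le_trans _ _ (\sum_(i < d) `|v| ^+ 2)).
  apply: ler_sum => i _; rewrite -expr2 -[leLHS]real_normK ?num_real //.
  by rewrite lerXn2r ?nnegrE // normr_coord_le.
rewrite sumr_const card_ord exprMn -[leLHS]mulr_natl ler_wpM2r ?sqr_ge0 //.
by rewrite -natrX ler_nat expnS expn1 mulSn (leq_trans (leqnSn d)) // leq_addr.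
Qed.

End Euclidean.

(** * Differential calculus along lines *)

Section Calculus.
Context (R : realType).

(** Restricting to lines turns questions on a differential into
questions on functions of one real variable. *)
Lemma is_derive_line (V W : normedModType R) (f : V -> W) (z w : V) (s : R) :
  differentiable f (z + s *: w) ->
  is_derive s 1 (fun r : R => f (z + r *: w)) ('d f (z + s *: w) w).
Proof.
move=> df.
have Hd : is_diff s (fun r : R => z + r *: w) (fun r : R => 0 + r *: w).
  exact: is_diffD.
have Hc : is_diff s (f \o (fun r : R => z + r *: w))
    ('d f (z + s *: w) \o (fun r : R => 0 + r *: w)).
  by apply: is_diff_comp; apply: differentiableP.
apply: DeriveDef; first exact: diff_derivable.
by rewrite deriveE // diff_val /= add0r scale1r.
Qed.

Lemma is_derive_coord (d : nat) (c : R -> 'rV[R]_d) (v : 'rV[R]_d) (s : R) i :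
  is_derive s 1 c v -> is_derive s 1 (fun r => c r 0 i) (v 0 i).
Proof.
move=> [cd <-]; rewrite derive_mx // mxE; apply: derivableP.
by move/derivable_mxP : cd.
Qed.

Lemma is_derive_dotp (d : nat) (c : R -> 'rV[R]_d) (v w : 'rV[R]_d) (s : R) :
  is_derive s 1 c v -> is_derive s 1 (fun r => dotp w (c r)) (dotp w v).
Proof.
move=> cv; have coord i := is_derive_coord i cv.
have -> : (fun r => dotp w (c r)) = \sum_(i < d) (fun r => w 0 i *: c r 0 i).
  by apply/funext => r; rewrite fct_sumE.
exact: is_derive_sum.
Qed.

Lemma differentiable_expansion (V W : normedModType R) (f : V -> W) (x : V) (e : R) :
  differentiable f x -> 0 < e ->
  exists2 r, 0 < r & forall h, `|h| < r -> `|f (x + h) - f x - 'd f x h| <= e * `|h|.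
Proof.
move=> /diff_locally /eqaddoP fE e0; have /nbhs_normP := fE _ e0.
move=> [r /= r0 Hr].
exists r => // h hr; have := Hr h; rewrite /= sub0r normrN => /(_ hr).
by rewrite -[(_ - _) h]/(f (h + x) - (f x + 'd f x h)) opprD addrA (addrC h).
Qed.

(** First-order expansion in space only, in terms of the row [grad_x] of
partial derivatives. *)
Lemma grad_x_expansion (d : nat) (xi : R * 'rV[R]_d -> R) (t : R) (x : 'rV[R]_d) (e : R) :
  differentiable xi (t, x) -> 0 < e ->
  exists2 r, 0 < r & forall y, `|y - x| < r ->
    `|xi (t, y) - xi (t, x) - dotp (grad_x xi t x) (y - x)| <= e * `|y - x|.
Proof.
move=> dxi e0; pose f y := xi (t, y).
have df : differentiable f x.
  have dp : differentiable (fun y : 'rV[R]_d => (t, y)) x.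
    by apply: differentiable_pair; [exact: differentiable_cst | exact: ex_diff].
  exact: (differentiable_comp dp dxi).
have gradE h : dotp (grad_x xi t x) h = 'd f x h.
  rewrite [in RHS](row_sum_delta h) linear_sum; apply: eq_bigr => i _.
  by rewrite linearZ mxE -deriveE // mulrC.
have [r r0 Hr] := differentiable_expansion df e0.
exists r => // y yr; have := Hr _ yr.
by rewrite subrKC gradE.
Qed.

Lemma norm_segment_lt (d : nat) (x y z : 'rV[R]_d) (r s : R) :
  `|y - x| < r -> `|z - x| < r -> 0 <= s <= 1 -> `|z + s *: (y - z) - x| < r.
Proof.
move=> yr zr /andP[s0 s1].
have -> : z + s *: (y - z) - x = (1 - s) *: (z - x) + s *: (y - x).
  by apply/rowP => i; rewrite !mxE; ring.
apply: (le_lt_trans (ler_normD _ _)); rewrite !normrZ (ger0_norm s0) ger0_norm ?subr_ge0 //.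
have [->|s_neq0] := eqVneq s 0; first by rewrite subr0 mul0r mul1r addr0.
have sp : 0 < s by rewrite lt_neqAle eq_sym s_neq0.
have : (1 - s) * `|z - x| <= (1 - s) * r by rewrite ler_wpM2l ?subr_ge0 // ltW.
have : s * `|y - x| < s * r by rewrite ltr_pM2l.
by lra.
Qed.

(** Two points near [x] are joined by a segment along which the
differential is uniformly close to ['d f x]; the mean value theorem on each
coordinate then bounds the error by [e * `|y - z|] for both points moving, not
only for increments from [x]. *)
Lemma C11_strict_differentiable (d m : nat) (U : set 'rV[R]_d)
    (f : 'rV[R]_d -> 'rV[R]_m) (x : 'rV[R]_d) (i : 'I_m) (e : R) :
  open U -> U x -> C11_on U f -> 0 < e ->
  exists2 r, 0 < r & forall y z, `|y - x| < r -> `|z - x| < r ->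
    U y /\ `|(f y - f z - 'd f x (y - z)) 0 i| <= e * `|y - z|.
Proof.
move=> oU Ux [df [M dfM]] e0.
have /nbhs_normP[r0 /= r0_gt0 r0U] : nbhs x U by exact: open_nbhs_nbhs.
have M1 : 0 < `|M| + 1 by rewrite ltr_wpDl.
pose r := Num.min r0 (e / (`|M| + 1)).
have r_gt0 : 0 < r by rewrite lt_min r0_gt0 divr_gt0.
have Mr : `|M| * r <= e.
  apply: (@le_trans _ _ ((`|M| + 1) * r)); first by rewrite ler_wpM2r ?lerDl ?ltW.
  by rewrite mulrC -ler_pdivlMr // ge_min lexx orbT.
have rU y : `|y - x| < r -> U y.
  by move=> yr; apply: r0U; rewrite /= distrC (lt_le_trans yr)// ge_min lexx.
exists r => // y z yr zr; split; first exact: rU.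
pose g (s : R) := f (z + s *: (y - z)) 0 i.
have seg (s : R) : 0 <= s <= 1 -> `|z + s *: (y - z) - x| < r by exact: norm_segment_lt.
have dg (s : R) : 0 <= s <= 1 -> is_derive s (1 : R) g (('d f (z + s *: (y - z)) (y - z)) 0 i).
  move=> s01; apply: (@is_derive_coord m (fun s : R => f (z + s *: (y - z)))).
  by apply: is_derive_line; apply: df; apply: rU; apply: seg.
have [||c c01] := @MVT R g (fun s : R => ('d f (z + s *: (y - z)) (y - z)) 0 i) 0 1 ltr01.
- by move=> s; rewrite in_itv /= => /andP[s0 s1]; apply: dg; rewrite !ltW.
- apply: derivable_within_continuous => s; rewrite in_itv /= => s01.
  by have [] := dg _ s01.
move: c01; rewrite in_itv /= => /andP[c0 c1].
rewrite /g scale0r addr0 scale1r subrKC subr0 mulr1 => gE.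
have c01 : 0 <= c <= 1 by rewrite !ltW.
(* [D] and [E] stand for the differentials at [x] and at the mean value point *)
have aux (p q D E : 'rV[R]_m) b : p 0 i - q 0 i = E 0 i -> `|E - D| <= b ->
    `|(p - q - D) 0 i| <= b.
  move=> pqE; apply: le_trans; apply: le_trans (normr_coord_le _ i).
  by rewrite !mxE pqE.
apply: (aux _ _ _ _ _ gE); apply: (le_trans (dfM _ _ (rU _ (seg _ c01)) Ux (y - z))).
apply: ler_wpM2r => //.
apply: le_trans Mr; apply: (@le_trans _ _ (`|M| * `|z + c *: (y - z) - x|)).
  by rewrite ler_wpM2r // ler_norm.
by rewrite ler_wpM2l // ltW // seg.
Qed.

End Calculus.

(** * Increments of Lipschitz functions *)

Section LipschitzGrowth.
Context (R : realType).

(** Cousin's principle: a transitive relation on the points of [[a, b]] which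
holds between points that straddle some [t] closely enough, for every [t], holds
from [a] to [b]. One looks at the supremum of the points related to [a]. *)
Lemma cousin_transitive (P : R -> R -> Prop) (a b : R) : a <= b ->
  (forall s t u, s <= t <= u -> P s t -> P t u -> P s u) ->
  (forall t, a <= t <= b -> exists2 e, 0 < e &
     forall s u, a <= s -> u <= b -> t - e < s <= t -> t <= u < t + e -> P s u) ->
  P a b.
Proof.
move=> ab Ptrans Ploc.
pose S := [set t | a <= t <= b /\ P a t].
have Sa : S a.
  split; first by rewrite lexx ab.
  have [|e e0 He] := Ploc a; first by rewrite lexx ab.
  by apply: He; rewrite ?lexx ?ltrBlDr ?ltrDl ?e0.
have Sub : ubound S b by move=> t [/andP[]].
have hS : has_sup S by split; [exists a | exists b].
have aT : a <= sup S by apply: sup_upper_bound.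
have Tb : sup S <= b by apply: sup_le_ub => //; exists a.
have [|e e0 He] := Ploc (sup S); first by rewrite aT Tb.
have [s [/andP[as_ sb] Ps] sT] := sup_adherent e0 hS.
have sS : s <= sup S by apply: sup_upper_bound => //; split=> //; rewrite as_.
pose u := Num.min b (sup S + e / 2).
have ub : u <= b by rewrite /u ge_min lexx.
have Su : sup S <= u by rewrite /u le_min Tb lerDl divr_ge0 ?ltW.
have Pu : P a u.
  apply: (Ptrans _ s) => //; first by rewrite as_ (le_trans sS).
  apply: He => //; first by rewrite sT sS.
  by rewrite Su /= /u gt_min ltrD2l ltr_pdivrMr // ltr_pMr ?ltr1n ?orbT.
have uS : u <= sup S by apply: sup_upper_bound => //; split=> //; rewrite (le_trans aT).
suff -> : b = u by [].
move: uS; rewrite /u ge_min gerDl => /orP[bS|]; last by rewrite leNgt divr_gt0.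
by apply/esym/min_idPl; rewrite (le_trans bS)// lerDl divr_ge0 ?ltW.
Qed.

(** The derivative at [t] controls increments between points on both sides
of [t], which is the local information that [cousin_transitive] asks for. *)
Lemma is_derive_straddle (f : R -> R) (t l e : R) : is_derive t 1 f l -> 0 < e ->
  exists2 r, 0 < r & forall s u, t - r < s <= t -> t <= u < t + r ->
    f u - f s <= (l + e) * (u - s).
Proof.
move=> [fd <-] e0.
have /cvgrPdist_lt/(_ _ e0)[r /= r0 Hr] := fd.
have key h : `|h| < r -> `|f (t + h) - f t - 'D_1 f t * h| <= e * `|h|.
  move=> hr; have [->|h0] := eqVneq h 0.
    by rewrite addr0 subrr mulr0 subr0 normr0 mulr0.
  have := Hr h; rewrite /ball_ /= sub0r normrN => /(_ hr h0).
  rewrite /GRing.scale /= mulr1 => /ltW H.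
  have -> : f (t + h) - f t - 'D_1 f t * h =
     - (('D_1 f t - h^-1 * (f (h + t) - f t)) * h).
    by rewrite (addrC h); field.
  by rewrite normrN normrM ler_wpM2r.
exists r => // s u /andP[s1 s2] /andP[u1 u2].
have h1 : `|u - t| < r by rewrite ger0_norm ?subr_ge0 // ltrBlDl.
have h2 : `|s - t| < r by rewrite ler0_norm ?subr_le0 // opprB ltrBlDl -ltrBlDr.
have := key _ h1; have := key _ h2.
have -> : `|u - t| = u - t by rewrite ger0_norm ?subr_ge0.
have -> : `|s - t| = t - s by rewrite ler0_norm ?subr_le0 // opprB.
have -> : t + (s - t) = s by ring.
have -> : t + (u - t) = u by ring.
rewrite !ler_norml.
by move=> /andP[? ?] /andP[? ?]; lra.
Qed.

(** Cover the exceptional null set by an open set [U] of measure at most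
[e]. At a point of [U] the Lipschitz bound is enough, because increments may be
charged to the part of [U] between the two points; elsewhere the derivative is
used. Both local bounds are additive over adjacent intervals, so that
[cousin_transitive] sums them, and the charge to [U] is [O(e)] in total. *)
Lemma lipschitz_ae_derive_le (f : R -> R) (a b c K : R) : a <= b ->
  (forall s t, a <= s <= b -> a <= t <= b -> `|f s - f t| <= K * `|s - t|) ->
  {ae (@lebesgue_measure R), forall t : R, a <= t <= b ->
     exists2 l, is_derive t (1 : R) f l & l <= c} ->
  f b - f a <= c * (b - a).
Proof.
move=> ab fK [N [mN N0 subN]].
have K0 : 0 <= `|K| + `|c| by rewrite addr_ge0.
apply/ler_addgt0Pr => e0 e0_gt0.
pose e := e0 / (b - a + (`|K| + `|c|) + 1).
have den : 0 < b - a + (`|K| + `|c|) + 1 by rewrite ltr_wpDl // addr_ge0 // subr_ge0.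
have e_gt0 : 0 < e by rewrite divr_gt0.
have eE : e * (b - a + (`|K| + `|c|) + 1) = e0 by rewrite /e divfK // gt_eqF.
have [|U [oU NU mU]] := lebesgue_regularity_outer mN _ e_gt0.
  by rewrite [ltLHS]N0 ltry.
have mU' : measurable U by exact: measurable_realfun.open_measurable.
have muU : (lebesgue_measure U <= e%:E)%E.
  have -> : U = (U `\` N) `|` N by rewrite setUC setDUK.
  apply: (le_trans (measureU2 _ _ _)) => //; first exact: measurableD.
  by rewrite [X in (_ + X)%E]N0 adde0 ltW.
pose nu s u := fine (@lebesgue_measure R (U `&` `]s, u])).
have mUI s u : measurable (U `&` `]s, u]%classic) by apply: measurableI.
have nuf s u : lebesgue_measure (U `&` `]s, u]%classic) \is a fin_num.
  rewrite ge0_fin_numE //; apply: (@le_lt_trans _ _ e%:E); last by rewrite ltry.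
  apply: (le_trans _ muU); apply: le_measure; rewrite ?inE;
    [exact: mUI | exact: mU' | exact: subIsetl].
have nu0 s u : 0 <= nu s u by rewrite fine_ge0.
have nue : nu a b <= e.
  rewrite -lee_fin fineK //.
  apply: (le_trans _ muU); apply: le_measure; rewrite ?inE;
    [exact: mUI | exact: mU' | exact: subIsetl].
have nuD s t u : s <= t <= u -> nu s u = nu s t + nu t u.
  move=> /andP[st tu].
  have dis : (U `&` `]s, t]%classic) `&` (U `&` `]t, u]%classic) = set0.
    apply/seteqP; split=> // x [] [_ /=]; rewrite in_itv /=.
    move=> /andP[_ h1] [_ /=]; rewrite in_itv /= => /andP[h2 _].
    by move: (le_lt_trans h1 h2); rewrite ltxx.
  apply: EFin_inj; rewrite EFinD !fineK //.
  have -> : U `&` `]s, u]%classic = (U `&` `]s, t]) `|` (U `&` `]t, u]).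
    by rewrite -setIUr -itv_bndbnd_setU // bnd_simp.
  exact: (measureU (@lebesgue_measure R) (mUI s t) (mUI t u) dis).
suff H : f b - f a <= (c + e) * (b - a) + (`|K| + `|c|) * nu a b.
  apply: (le_trans H); rewrite mulrDl -addrA lerD2l -eE.
  have := ler_wpM2l K0 nue; have : 0 <= b - a by rewrite subr_ge0.
  by nra.
apply: (@cousin_transitive (fun s u => f u - f s <= (c + e) * (u - s) + (`|K| + `|c|) * nu s u)) => //.
  by move=> s t u stu h1 h2; rewrite (nuD s t u) //; lra.
move=> t tab.
have [Nt|Nt] := pselect (N t).
  have /nbhs_ballP[r /= r0 rU] : nbhs t U by apply: open_nbhs_nbhs; split=> //; apply: NU.
  exists r => // s u as_ ub /andP[s1 s2] /andP[u1 u2].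
  have sub : `]s, u]%classic `<=` U.
    move=> x /=; rewrite in_itv /= => /andP[sx xu]; apply: rU.
    by rewrite /ball /= ltr_norml; apply/andP; split; lra.
  have -> : nu s u = u - s.
    rewrite /nu setIidr // lebesgue_measure_itv /= lte_fin.
    by case: ltP => // us; apply/eqP; rewrite /= eq_sym subr_eq0 eq_le us; lra.
  have us : 0 <= u - s by lra.
  have h1 : f u - f s <= K * (u - s).
    apply: (le_trans (ler_norm _)); rewrite -[u - s]ger0_norm //.
    by apply: fK; apply/andP; split; lra.
  have := ler_wpM2r us (ler_norm K); have := ler_wpM2r us (ler_norm (- c)).
  rewrite normrN; have := mulr_ge0 (ltW e_gt0) us; lra.
have [l lf lc] : exists2 l, is_derive t (1 : R) f l & l <= c.
  by apply: contrapT => h; apply: Nt; apply: subN => /= /(_ tab).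
have [r r0 Hr] := is_derive_straddle lf e_gt0.
exists r => // s u as_ ub st tu; apply: (le_trans (Hr _ _ st tu)).
have us : 0 <= u - s by move: st tu => /andP[_ st] /andP[tu _]; rewrite subr_ge0 (le_trans st).
have := ler_wpM2r us lc; have := mulr_ge0 K0 (nu0 s u).
by lra.
Qed.

End LipschitzGrowth.

(** * Defining functions of the boundary *)

Section Geometry.
Context (R : realType) (d : nat).
Implicit Types (Omega : set 'rV[R]_d) (x y z n : 'rV[R]_d).

(** [psi] is a defining function of the boundary near [x], normalised by its
gradient [n] at [x]. Strict differentiability makes the error proportional to
the distance between the two points, however close to each other they are. *)
Definition defining_function Omega x n (psi : 'rV[R]_d -> R) : Prop :=
  forall e, 0 < e -> exists2 r, 0 < r &
    (forall y z, `|y - x| < r -> `|z - x| < r ->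
       `|psi y - psi z - dotp n (y - z)| <= e * `|y - z|) /\
    (forall y, `|y - x| < r -> boundary Omega y <-> psi y = 0).

(** In a chart [Phi] which straightens the boundary, the last coordinate
vanishes exactly on the boundary, and the vectors on which its differential
[alpha] vanishes are tangent, hence orthogonal to [n]. So [alpha] is
proportional to [dotp n], and dividing by [alpha n] gives [psi]. *)
Lemma C11_boundary_defining_function Omega x n : (0 < d)%N ->
  C11_submanifold d.-1 (boundary Omega) -> boundary Omega x ->
  enorm n = 1 -> (forall v, tangent_vector (boundary Omega) x v -> dotp n v = 0) ->
  exists psi, defining_function Omega x n psi.
Proof.
move=> d0 sub Mx n1 ntan.
have [U [W [Phi [oU Ux oW [PhiU [cPhi [Psi [cPsi PsiK]]]] PhiM]]]] := sub x Mx.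
have lt_d : (d.-1 < d)%N by rewrite ltn_predL.
pose l := Ordinal lt_d.
have leI (i : 'I_d) : (d.-1 <= i)%N -> i = l.
  by move=> di; apply/val_inj/eqP; rewrite /= eqn_leq di andbT -ltnS prednK.
have PhiW y : U y -> W (Phi y) by move=> Uy; rewrite -PhiU; exists y.
have PsiM w : W w -> w 0 l = 0 -> boundary Omega (Psi w).
  move=> Ww wl; have : (Phi @` (U `&` boundary Omega)) w.
    by rewrite PhiM; split=> // i /leI ->.
  by move=> [y [Uy My] <-]; rewrite PsiK.
have Phix0 : (Phi x) 0 l = 0.
  have : (Phi @` (U `&` boundary Omega)) (Phi x) by exists x.
  by rewrite PhiM => -[_]; apply.
have dPhi : differentiable Phi x by apply: cPhi.1.
have dPsi : differentiable Psi (Phi x) by apply: cPsi.1; exact: PhiW.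
(* chain rule for the identity [Psi \o Phi] *)
have dK v : 'd Psi (Phi x) ('d Phi x v) = v.
  transitivity ('D_v (Psi \o Phi) x).
    rewrite deriveE; last exact: differentiable_comp.
    exact: (esym (congr1 (@^~ v) (diff_comp dPhi dPsi))).
  have -> : 'D_v (Psi \o Phi) x = 'D_v id x.
    apply: near_eq_derive; have := open_nbhs_nbhs (conj oU Ux).
    by apply: filterS => y /PsiK.
  exact: derive_id.
pose alpha v : R := ('d Phi x v) 0 l.
have alpha_tan v : alpha v = 0 -> dotp n v = 0.
  move=> av; apply: ntan; exists (fun s : R => Psi (Phi x + s *: 'd Phi x v)).
  split.
  - by rewrite scale0r addr0 PsiK.
  - have cl : {for (0 : R), continuous (fun s : R => Phi x + s *: 'd Phi x v)}.
      apply: differentiable_continuous; apply: ex_diff.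
    have : nbhs (Phi x + 0 *: 'd Phi x v) W.
      by rewrite scale0r addr0; apply: open_nbhs_nbhs; split=> //; exact: PhiW.
    move=> /cl Wn.
    have : nbhs (0 : R) (fun s : R => W (Phi x + s *: 'd Phi x v)) by exact: Wn.
    apply: (@filterS _ (nbhs (0 : R))) => s Ws; apply: (PsiM _ Ws).
    by move: av; rewrite /alpha => av; rewrite mxE Phix0 add0r mxE av mulr0.
  - rewrite -[v in is_derive _ _ _ v]dK.
    have := @is_derive_line R _ _ Psi (Phi x) ('d Phi x v) 0.
    by rewrite scale0r addr0; apply.
have dotnn : dotp n n = 1 by rewrite -enorm_sqr n1 expr1n.
have an : alpha n != 0.
  by apply/eqP => /alpha_tan; rewrite dotnn => /eqP; rewrite oner_eq0.
have alphaE v : dotp n v = alpha v / alpha n.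
  have : alpha (v - (alpha v / alpha n) *: n) = 0.
    by rewrite /alpha linearB linearZ !mxE -/(alpha v) -/(alpha n) divfK ?subrr.
  by move=> /alpha_tan; rewrite dotpBr dotpZr dotnn mulr1 => /eqP; rewrite subr_eq0 => /eqP.
exists (fun y => (Phi y) 0 l / alpha n) => e e0.
have e1 : 0 < e * `|alpha n| by rewrite mulr_gt0 // normr_gt0.
have [r r0 Hr] := C11_strict_differentiable l oU Ux cPhi e1.
exists r => //; split=> [y z yr zr|y yr].
  have [_ H] := Hr y z yr zr.
  have aux (p q D : 'rV[R]_d) (a b : R) : a != 0 -> `|(p - q - D) 0 l| <= b * `|a| ->
     `|p 0 l / a - q 0 l / a - D 0 l / a| <= b.
    move=> a0; rewrite -!mulrBl normrM normfV ler_pdivrMr ?normr_gt0 //.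
    by rewrite !mxE.
  rewrite alphaE; apply: aux => //.
  by apply: (le_trans H); rewrite mulrAC.
have [Uy _] := Hr y y yr yr; split=> [My|/eqP].
  have : (Phi @` (U `&` boundary Omega)) (Phi y) by exists y.
  by rewrite PhiM => -[_ /(_ l (leqnn _))] /= ->; rewrite mul0r.
rewrite mulf_eq0 invr_eq0 (negbTE an) orbF => /eqP Phiy0.
by rewrite -(PsiK y Uy); apply: PsiM => //; exact: PhiW.
Qed.

End Geometry.

(** * The two sides of the boundary *)

Section LocalSide.
Context (R : realType) (d : nat).
Implicit Types (Omega : set 'rV[R]_d) (x y z n : 'rV[R]_d).

(** Off its boundary an open set is also relatively closed, so a segment,
being connected, cannot pass from one side to the other without meeting the
boundary. *)
Lemma segment_off_boundary Omega y z : open Omega ->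
  (forall s : R, 0 <= s <= 1 -> ~ boundary Omega (y + s *: (z - y))) ->
  closure Omega y -> closure Omega z.
Proof.
move=> oO noB Oy; pose f (s : R) : 'rV[R]_d := y + s *: (z - y).
have cf : continuous f.
  by move=> s; apply: differentiable_continuous; apply: ex_diff.
have cE : connected (f @` `[0, 1]%classic).
  apply: connected_continuous_connected; first exact: segment_connected.
  exact: continuous_subspaceT.
have E0 : (f @` `[0, 1]%classic) y.
  by exists 0; [rewrite /= in_itv /= lexx ler01 | rewrite /f scale0r addr0].
have E1 : (f @` `[0, 1]%classic) z.
  by exists 1; [rewrite /= in_itv /= lexx ler01 | rewrite /f scale1r subrKC].
have clE p : (f @` `[0, 1]%classic) p -> closure Omega p -> Omega p.
  move=> [s]; rewrite /= in_itv /= => s01 <- Op.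
  apply: contrapT => nO; apply: (noB s s01); split=> // Oi; apply: nO.
  exact: interior_subset.
suff EO : f @` `[0, 1]%classic `&` Omega = f @` `[0, 1]%classic.
  by move: E1; rewrite -EO => -[_]; exact: subset_closure.
apply: cE; first by exists y; split=> //; exact: clE.
  by exists Omega.
exists (closure Omega); first exact: closed_closure.
apply/seteqP; split=> p [Ep Op]; split=> //; first exact: subset_closure.
exact: clE.
Qed.

(** The outward normal decides the sides. From a point with [psi > 0], go up
along [n], then sideways to [x + rho *: n], which is outside: [psi] stays
positive, so the boundary is never crossed and the starting point is outside.
Hence points of the open set near [x] have [psi < 0]; any other point with
[psi < 0] is joined to one of them by going down along [n], sideways, and up. *)
Lemma defining_function_sublevel Omega x n psi : open Omega ->
  defining_function Omega x n psi -> boundary Omega x ->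
  enorm n = 1 -> (\forall s \near (0 : R)^'+, ~ closure Omega (x + s *: n)) ->
  exists2 r, 0 < r & forall y, `|y - x| < r -> closure Omega y <-> psi y <= 0.
Proof.
move=> oO dpsi Mx n1 nout.
have half : 0 < (2^-1 : R) by rewrite invr_gt0.
have [r0 r0_gt0 [psi_diff psi_bd]] := dpsi _ half.
have [rho rho_gt0 [rho_r0 xrho]] : exists2 rho : R, 0 < rho &
    rho < r0 / 2 /\ ~ closure Omega (x + rho *: n).
  near (0 : R)^'+ => rho; exists rho; first by [].
  split; last by near: rho.
  by near: rho; apply: nbhs_right_lt; rewrite divr_gt0.
have dotnn : dotp n n = 1 by rewrite -enorm_sqr n1 expr1n.
have normn : `|n| <= 1 by rewrite -n1 normr_le_enorm.
pose c : R := d.+1%:R.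
have c1 : 1 <= c by rewrite /c ler1n.
have dotn v : `|dotp n v| <= c * `|v|.
  by rewrite (le_trans (normr_dotp_le _ _))// n1 mul1r enorm_le_normr.
pose r := rho / (4 * c).
have c0 : 0 < c by lra.
have r_gt0 : 0 < r by rewrite divr_gt0 // mulr_gt0.
have rc : c * r = rho / 4 by rewrite /r; field; lra.
have r_rho : r <= rho / 4 by nra.
have psix : psi x = 0 by apply/(psi_bd x) => //; rewrite subrr normr0.
have near_n y (s : R) : `|y - x| < r -> `|s| <= rho -> `|y + s *: n - x| < r0.
  move=> yr srho; rewrite addrAC (le_lt_trans (ler_normD _ _)) // normrZ.
  have : `|s| * `|n| <= rho * 1 by apply: ler_pM.
  lra.
have along_n y (s : R) : `|y - x| < r -> `|s| <= rho ->
    `|psi (y + s *: n) - psi y - s| <= `|s| / 2.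
  move=> yr srho.
  have yr0 : `|y - x| < r0 by lra.
  have := psi_diff _ _ (near_n y s yr srho) yr0.
  rewrite [y + _]addrC addrK dotpZr dotnn mulr1 normrZ => h.
  by apply: (le_trans h); rewrite [leRHS]mulrC ler_wpM2l ?ler_piMr // ltW.
(* at height [s] above or below the tangent plane, [psi] has the sign of [s] *)
have across y (s : R) : `|y - x| < r -> `|s| = rho ->
    `|psi (y + s *: n) - s| < rho.
  move=> yr srho.
  have yr0 : `|y - x| < r0 by lra.
  have xr0 : `|x - x| < r0 by rewrite subrr normr0.
  have h1 : `|psi (y + s *: n) - psi y - s| <= rho / 2.
    by rewrite -srho; apply: along_n => //; rewrite srho.
  have h2 := psi_diff _ _ yr0 xr0.
  have h3 := dotn (y - x).
  have h4 : c * `|y - x| < rho / 4 by rewrite -rc ltr_pM2l.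
  move: h1 h2 h3; rewrite psix !ler_norml ltr_norml.
  by move=> /andP[? ?] /andP[? ?] /andP[? ?]; apply/andP; split; lra.
have conv y z (s t : R) : `|y - x| < r -> `|z - x| < r -> 0 <= s <= 1 ->
    y + t *: n + s *: ((z + t *: n) - (y + t *: n)) = (y + s *: (z - y)) + t *: n /\
    `|y + s *: (z - y) - x| < r.
  move=> yr zr s01; split; last exact: norm_segment_lt.
  by apply/rowP => i; rewrite !mxE; ring.
have xr : `|x - x| < r by rewrite subrr normr0.
(* sideways move at height [t] *)
have up y z (t : R) : `|y - x| < r -> `|z - x| < r -> `|t| = rho ->
   closure Omega (y + t *: n) -> closure Omega (z + t *: n).
  move=> yr zr trho; apply: (segment_off_boundary oO) => s s01.
  have [-> ysr] := conv y z s t yr zr s01.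
  rewrite (psi_bd _ (near_n _ t ysr _)) ?trho // => psi0.
  by have := across _ t ysr trho; rewrite psi0 sub0r normrN trho ltxx.
(* normal move, in the direction in which [psi] grows in absolute value *)
have normal y (t : R) : `|y - x| < r -> `|t| = rho -> 0 < t * psi y ->
   closure Omega y <-> closure Omega (y + t *: n).
  move=> yr trho tpsi.
  have main (s : R) : 0 <= s <= 1 -> ~ boundary Omega (y + (s * t) *: n).
    move=> /andP[s0 s1].
    have st : `|s * t| <= rho by rewrite normrM trho ger0_norm // ger_pMl.
    rewrite (psi_bd _ (near_n _ _ yr st)) => psi0.
    have := along_n y (s * t) yr st; rewrite psi0 sub0r normrM (ger0_norm s0).
    rewrite ler_norml; have [t0|t0] := ltP 0 t.
      rewrite pmulr_rgt0 // in tpsi; rewrite gtr0_norm // => /andP[h _].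
      by have := mulr_ge0 s0 (ltW t0); lra.
    have t1 : t < 0 by rewrite lt_neqAle t0 andbT; apply: contraTneq tpsi => ->; rewrite mul0r ltxx.
    rewrite nmulr_rgt0 // in tpsi; rewrite ltr0_norm // => /andP[_ h].
    have st0 : s * t <= 0 by rewrite mulr_ge0_le0.
    by lra.
  have main1 (s : R) : 0 <= s <= 1 -> ~ boundary Omega (y + s *: (y + t *: n - y)).
    have -> : y + s *: (y + t *: n - y) = y + (s * t) *: n.
      by apply/rowP => i; rewrite !mxE; ring.
    exact: main.
  split; first exact: (segment_off_boundary oO main1).
  apply: (segment_off_boundary oO) => s s01.
  have -> : y + t *: n + s *: (y - (y + t *: n)) = y + ((1 - s) * t) *: n.
    by apply/rowP => i; rewrite !mxE; ring.
  by apply: main; lra.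
have pos y : `|y - x| < r -> 0 < psi y -> ~ closure Omega y.
  move=> yr psi_gt0 Oy.
  have arho : `|rho| = rho by rewrite gtr0_norm.
  apply: xrho; apply: (up y) => //.
  by apply/(normal y rho) => //; rewrite mulr_gt0.
exists r => // y yr; split=> [Oy|].
  by rewrite leNgt; apply/negP => /pos - /(_ yr).
rewrite le_eqVlt => /orP[/eqP psi0|psi_lt0].
  have yr0 : `|y - x| < r0 by lra.
  by have [] := (psi_bd y yr0).2 psi0.
have [z [Oz zr]] : exists z, Omega z /\ `|z - x| < r.
  have [z [Oz zr]] := Mx.1 _ (nbhsx_ballx x r r_gt0).
  by exists z; split=> //; move: zr; rewrite -ball_normE /= distrC.
have zr0 : `|z - x| < r0 by lra.
have psiz : psi z < 0.
  rewrite lt_neqAle; apply/andP; split.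
    by apply/eqP => /(psi_bd z zr0)[_]; apply; move/interior_id : oO => ->.
  rewrite leNgt; apply/negP => /(pos _ zr); apply; exact: subset_closure.
have nrho : `|- rho| = rho by rewrite normrN gtr0_norm.
apply/(normal y (- rho)) => //; first by rewrite nmulr_rgt0 // oppr_lt0.
apply: (up z) => //; apply/(normal z (- rho)) => //.
  by rewrite nmulr_rgt0 // oppr_lt0.
exact: subset_closure.
Unshelve. all: by end_near.
Qed.

End LocalSide.

(** * Tangency and interior segments *)

Section Cone.
Context (R : realType) (d : nat).
Implicit Types (Omega : set 'rV[R]_d) (x y z n : 'rV[R]_d).

(** Near [x] the domain enters the proof only through this function. *)
Lemma C11_domain_sublevel Omega x n : (0 < d)%N -> open Omega ->
  C11_submanifold d.-1 (boundary Omega) -> boundary Omega x ->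
  outward_unit_normal Omega x n ->
  exists psi : 'rV[R]_d -> R, psi x = 0 /\
    forall e, 0 < e -> exists2 r, 0 < r &
      (forall y z, `|y - x| < r -> `|z - x| < r ->
         `|psi y - psi z - dotp n (y - z)| <= e * `|y - z|) /\
      (forall y, `|y - x| < r -> closure Omega y <-> psi y <= 0).
Proof.
move=> d0 oO sub Mx [n1 ntan nout].
have [psi dpsi] := C11_boundary_defining_function d0 sub Mx n1 ntan.
have [r1 r1_gt0 sublevel] := defining_function_sublevel oO dpsi Mx n1 nout.
exists psi; split.
  have [r r0 [_ bd]] := dpsi 1 ltr01.
  by apply/(bd x) => //; rewrite subrr normr0.
move=> e e0; have [r r0 [H _]] := dpsi e e0.
exists (Num.min r r1); first by rewrite lt_min r0.
by split=> [y z|y]; rewrite !lt_min => /andP[y1 y2];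
  [move=> /andP[z1 z2]; exact: H | exact: sublevel].
Qed.

(** Displacements from [x] inside the closed domain are inward up to first
order, since [psi] is nonpositive on the domain and [dotp n] is its derivative. *)
Lemma dotp_normal_le Omega x n (e : R) : (0 < d)%N -> open Omega ->
  C11_submanifold d.-1 (boundary Omega) -> boundary Omega x ->
  outward_unit_normal Omega x n -> 0 < e ->
  exists2 r, 0 < r & forall b, closure Omega b -> `|b - x| < r ->
    dotp n (b - x) <= e * `|b - x|.
Proof.
move=> d0 oO sub Mx on e0.
have [psi [psix Hpsi]] := C11_domain_sublevel d0 oO sub Mx on.
have [r r0 [H sublevel]] := Hpsi e e0.
exists r => // b Ob br.
have xr : `|x - x| < r by rewrite subrr normr0.
have /(sublevel b br) := Ob.
by have := H b x br xr; rewrite psix ler_norml => /andP[? ?] ?; lra.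
Qed.

(** Uniform interior segments, at scale [eps]: [a] is deeper than [eps / 2]
and [b] is any point of the closed domain at distance [O(eps)]. If the first-order
bound for [psi a - psi b] is nonpositive, it also bounds [psi] on the segment by
[psi b]. Otherwise [b] lies at a depth comparable with [eps], hence so does the
whole segment, while the boundary deviates from its tangent plane by a small
fraction of [eps]. *)
Lemma inward_segment Omega x n (C : R) : (0 < d)%N -> open Omega ->
  C11_submanifold d.-1 (boundary Omega) -> boundary Omega x ->
  outward_unit_normal Omega x n -> 0 < C ->
  exists2 r, 0 < r & forall (eps : R) a b, 0 < eps -> C * eps < r ->
    `|a - x| <= C * eps -> `|b - x| <= C * eps ->
    dotp n (a - x) <= - (eps / 2) -> closure Omega b ->
    forall s, 0 <= s <= 1 -> closure Omega (a + s *: (b - a)).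
Proof.
move=> d0 oO sub Mx on C0.
have [psi [psix Hpsi]] := C11_domain_sublevel d0 oO sub Mx on.
have e0 : 0 < (6 * C)^-1 by rewrite invr_gt0 mulr_gt0.
have [r r0 [H sublevel]] := Hpsi _ e0.
exists r => // eps a b eps0 Cr aC bC na Ob s s01.
have ar := le_lt_trans aC Cr; have br := le_lt_trans bC Cr.
have xr : `|x - x| < r by rewrite subrr normr0.
set c := a + _.
have cr : `|c - x| < r by exact: norm_segment_lt.
apply/(sublevel c cr).
have /(sublevel b br) psib := Ob.
have ab : `|a - b| <= 2 * (C * eps).
  have -> : a - b = (a - x) - (b - x) by rewrite opprB addrA subrK.
  by apply: (le_trans (ler_normB _ _)); lra.
have eC : (6 * C)^-1 * (C * eps) = eps / 6 by field; lra.
have cb : c - b = (1 - s) *: (a - b) by apply/rowP => i; rewrite !mxE; ring.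
(* the sign of a bound for the growth of [psi] from [b] to [a] decides *)
have [inner|outer] := leP (dotp n (a - b) + (6 * C)^-1 * `|a - b|) 0.
  have := H c b cr br; rewrite cb dotpZr normrZ ger0_norm; last by lra.
  rewrite ler_norml => /andP[_ h].
  have : (1 - s) * (dotp n (a - b) + (6 * C)^-1 * `|a - b|) <= 0.
    by rewrite mulr_ge0_le0 //; lra.
  by lra.
have hab : (6 * C)^-1 * `|a - b| <= eps / 3.
  by apply: (le_trans (ler_wpM2l (ltW e0) ab)); lra.
have cC : `|c - x| <= C * eps.
  have -> : c - x = (1 - s) *: (a - x) + s *: (b - x).
    by apply/rowP => i; rewrite !mxE; ring.
  apply: (le_trans (ler_normD _ _)); rewrite !normrZ !ger0_norm; [|lra|lra].
  have [s0 s1] : 0 <= s /\ 0 <= 1 - s by lra.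
  by have := ler_wpM2l s1 aC; have := ler_wpM2l s0 bC; lra.
have hcx : (6 * C)^-1 * `|c - x| <= eps / 6.
  by apply: (le_trans (ler_wpM2l (ltW e0) cC)); rewrite eC.
have := H c x cr xr; rewrite psix ler_norml => /andP[_ h].
have nc : dotp n (c - x) = dotp n (a - x) - s * dotp n (a - b).
  have -> : c - x = (a - x) - s *: (a - b) by apply/rowP => i; rewrite !mxE; ring.
  by rewrite dotpBr dotpZr.
have sab : - s * dotp n (a - b) <= eps / 3.
  have : 0 <= s * (dotp n (a - b) + eps / 3) by rewrite mulr_ge0 //; lra.
  have : s * (eps / 3) <= 1 * (eps / 3) by rewrite ler_wpM2r //; lra.
  by lra.
by move: nc h hcx sab na; rewrite subr0; clear; lra.
Qed.

End Cone.

(** * Speed of admissible trajectories *)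

Section Trajectories.
Context (R : realType) (d : nat).
Implicit Types (Omega : set 'rV[R]_d) (gamma : R -> 'rV[R]_d).

Lemma lipschitzP_on (A : set R) gamma :
  [lipschitz gamma t | t in A] <->
  exists M : R, forall s t, A s -> A t -> `|gamma s - gamma t| <= M * `|s - t|.
Proof.
split=> [/pinfty_ex_gt0[M M0 HM]|[M HM]].
  by exists M => s t As At; exact: (HM (s, t)).
have [->|/set0P[a Aa]] := eqVneq A set0; first exact: lipschitz_set0.
apply: (@klipschitzW _ _ _ M).
  exact: (@globally_properfilter _ _ (a, a)).
by move=> [s t] /= [As At]; exact: HM.
Qed.

(** Apply the one-dimensional inequality to the component of the trajectory
along the displacement itself, whose derivative is at most [c * enorm v]
by the Cauchy-Schwarz inequality. *)
Lemma Adm_speed Omega k gamma (t1 t2 c : R) : Adm Omega k gamma ->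
  0 <= t1 <= t2 ->
  (forall t, t1 <= t <= t2 -> 0 <= k t (gamma t) <= c) ->
  enorm (gamma t2 - gamma t1) <= c * (t2 - t1).
Proof.
move=> [_ /lipschitzP_on[M gM] [u [_ u1 du]]] /andP[t10 t12] kc.
set v := gamma t2 - gamma t1.
have v0 := enorm_ge0 v.
have [->|vn0] := eqVneq (enorm v) 0.
  have /andP[k0 kc1] : 0 <= k t1 (gamma t1) <= c by apply: kc; rewrite lexx.
  by rewrite mulr_ge0 ?subr_ge0 // (le_trans k0).
have vp : 0 < enorm v by rewrite lt_neqAle eq_sym vn0.
suff : dotp v (gamma t2) - dotp v (gamma t1) <= (enorm v * c) * (t2 - t1).
  by rewrite -dotpBr -/v -enorm_sqr expr2 -mulrA ler_pM2l.
apply: (@lipschitz_ae_derive_le R (fun t => dotp v (gamma t)) t1 t2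
    (enorm v * c) (enorm v * (d.+1%:R * M))) => //.
  move=> s t /andP[s1 s2] /andP[st1 st2]; rewrite -dotpBr.
  apply: (le_trans (normr_dotp_le _ _)); rewrite -mulrA ler_wpM2l //.
  apply: (le_trans (enorm_le_normr _)); rewrite -mulrA ler_wpM2l //.
  by apply: gM => /=; [rewrite (le_trans t10)|rewrite (le_trans t10)].
apply: (@filterS _ _ (ae_filter_ringOfSetsType (@lebesgue_measure R)) _ _ _ du) => t dut t12'.
have t0 : 0 <= t by move: t12' => /andP[? _]; exact: le_trans t10 _.
have /andP[k0 kc1] := kc t t12'.
exists (dotp v (k t (gamma t) *: u t)); first by apply: is_derive_dotp; exact: dut.
apply: (le_trans (cauchy_schwarz _ _)); rewrite ler_wpM2l // enormZ ger0_norm //.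
by apply: (le_trans _ kc1); rewrite ler_piMr // u1.
Qed.

End Trajectories.

(** * Replacing an initial arc by a segment *)

Section Detour.
Context (R : realType) (d : nat).
Implicit Types (Omega : set 'rV[R]_d) (gamma : R -> 'rV[R]_d).

Lemma speed_within_continuous Omega (k : R -> 'rV[R]_d -> R)
    (hkc : {within space_time Omega, continuous (fun z => k z.1 z.2)})
    t0 x0 (e : R) : 0 <= t0 -> closure Omega x0 -> 0 < e ->
  exists2 r, 0 < r & forall t x, 0 <= t -> closure Omega x ->
    `|t - t0| < r -> `|x - x0| < r -> `|k t x - k t0 x0| < e.
Proof.
move=> t00 Ox0 e0.
have /subspace_continuousP := hkc => /(_ (t0, x0) (conj t00 Ox0)).
move=> /cvgrPdist_lt/(_ _ e0) /= /nbhs_ballP[r /= r0 Hr].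
exists r => // t x tge0 Ox tr xr; rewrite distrC.
by apply: (Hr (t, x)) => //; split; rewrite /= -ball_normE /= distrC.
Qed.

Lemma measurable_if_lt (D : set R) (f g : R -> R) (c : R) : measurable D ->
  measurable_fun D f -> measurable_fun D g ->
  measurable_fun D (fun t => if t < c then f t else g t).
Proof.
move=> mD mf mg; apply: measurable_fun_if => //.
- exact: measurable_fun_ltr.
- by apply: measurable_funS mf => // x [].
- by apply: measurable_funS mg => // x [].
Qed.

(** The new trajectory rests at [a] until [t0], runs along the segment at
constant velocity, and joins [gamma] at time [t0 + T]. The last hypothesis says
that this velocity is allowed by [k]; resting is allowed since the control may
vanish. *)
Lemma Adm_detour Omega (k : R -> 'rV[R]_d -> R) gamma (t0 T : R) (a : 'rV[R]_d) :
  {within space_time Omega, continuous (fun z => k z.1 z.2)} ->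
  (forall t x, 0 <= t -> closure Omega x -> 0 < k t x) ->
  Adm Omega k gamma -> 0 <= t0 -> 0 < T ->
  (forall s : R, 0 <= s <= 1 -> closure Omega (a + s *: (gamma (t0 + T) - a))) ->
  (forall t s : R, t0 <= t <= t0 + T -> 0 <= s <= 1 ->
     enorm (gamma (t0 + T) - a) <= T * k t (a + s *: (gamma (t0 + T) - a))) ->
  exists gamma', [/\ Adm Omega k gamma', gamma' t0 = a &
    forall t, t0 + T <= t -> gamma' t = gamma t].
Proof.
move=> hkc kpos [gO /lipschitzP_on[M gM] [u [mu u1 du]]] t00 T0 segO segk.
set t1 := t0 + T; set b := gamma t1.
have t01 : t0 < t1 by rewrite /t1 ltrDl.
(* Time is clamped to [[t0, t1]], which makes the segment part and its speed
   total continuous functions of time. *)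
pose w (t : R) := Num.max t0 (Num.min t1 t).
have w01 t : t0 <= w t <= t1.
  by rewrite /w le_max lexx /= ge_max ge_min lexx andbT ltW.
have wE t : t0 <= t <= t1 -> w t = t.
  by move=> /andP[h1 h2]; rewrite /w (min_idPr h2) (max_idPr h1).
have wlip s t : `|w s - w t| <= `|s - t|.
  rewrite /w; have := ltW t01; clear; rewrite !minEle !maxEle ler_norml.
  have := ler_norm (s - t); have := ler_norm (t - s); rewrite (distrC t s).
  case: (leP t1 s) => ?; case: (leP t1 t) => ?; do ?case: (leP t0 _) => ?;
    by move=> ? ? ?; apply/andP; split; lra.
pose sig t := (w t - t0) / T.
have sig01 t : 0 <= sig t <= 1.
  have /andP[h1 h2] := w01 t.
  apply/andP; split; first by rewrite divr_ge0 ?subr_ge0 // ltW.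
  by rewrite /sig ler_pdivrMr // mul1r lerBlDl.
pose l t := a + sig t *: (b - a).
have lO t : closure Omega (l t) by exact: segO.
have llip s t : `|l s - l t| <= (`|b - a| / T) * `|s - t|.
  have -> : l s - l t = ((w s - w t) / T) *: (b - a).
    by apply/rowP => i; rewrite !mxE /sig; field; rewrite gt_eqF.
  rewrite normrZ normrM [`|T^-1|]gtr0_norm ?invr_gt0 //.
  have -> : `|w s - w t| / T * `|b - a| = (`|b - a| / T) * `|w s - w t| by ring.
  by apply: ler_wpM2l => //; rewrite divr_ge0 // ltW.
have lt0 t : t <= t0 -> l t = a.
  move=> tt0; have wt : w t = t0.
    by rewrite /w; apply/max_idPl; rewrite ge_min tt0 orbT.
  by rewrite /l /sig wt subrr mul0r scale0r addr0.
have lt1 : l t1 = b.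
  have wt1 : w t1 = t1 by rewrite wE // lexx ltW.
  by rewrite /l /sig wt1 {1}/t1 addrAC subrr add0r divff ?gt_eqF // scale1r subrKC.
have t10 : 0 <= t1 by rewrite (le_trans t00) // ltW.
have w0 t : 0 <= w t by have /andP[h _] := w01 t; exact: le_trans h.
pose h t := k (w t) (l t).
have hpos t : 0 < h t by apply: kpos.
have hcont : continuous h.
  move=> t; apply/cvgrPdist_lt => e e0.
  have [r r0 Hr] := speed_within_continuous hkc (w0 t) (lO t) e0.
  pose C := 1 + `|b - a| / T.
  have C0 : 0 < C by rewrite ltr_pwDl // divr_ge0 // ltW.
  apply/nbhs_ballP; exists (r / C) => /=; first by rewrite divr_gt0.
  move=> s; rewrite /ball /= ltr_pdivlMr // mulrDr mulr1 => str.
  have st0 := normr_ge0 (t - s).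
  have bT0 : 0 <= `|t - s| * (`|b - a| / T) by rewrite mulr_ge0 // divr_ge0 // ltW.
  rewrite distrC; apply: Hr => //; rewrite distrC.
    by apply: (le_lt_trans (wlip _ _)); lra.
  by apply: (le_lt_trans (llip _ _)); rewrite mulrC; lra.
pose gamma' t := if t < t1 then l t else gamma t.
pose u' t := if t < t0 then 0 else if t < t1 then (T * h t)^-1 *: (b - a) else u t.
have mD : measurable [set t : R | 0 <= t].
  have -> : [set t : R | 0 <= t] = `[0, +oo[%classic.
    by apply/seteqP; split=> x /=; rewrite in_itv /= andbT.
  exact: measurable_itv.
exists gamma'; split; last 2 first.
- by rewrite /gamma' t01 lt0.
- by move=> t tt1; rewrite /gamma' ltNge tt1.
split.
- by move=> t tge0; rewrite /gamma'; case: ifP => // _; exact: gO.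
- apply/lipschitzP_on; exists (`|b - a| / T + `|M|).
  have A0 : 0 <= `|b - a| / T by rewrite divr_ge0 // ltW.
  have gM' s t : 0 <= s -> 0 <= t -> `|gamma s - gamma t| <= `|M| * `|s - t|.
    by move=> s0 t'0; apply: (le_trans (gM _ _ s0 t'0)); rewrite ler_wpM2r // ler_norm.
  have cross s t : s < t1 -> t1 <= t -> `|l s - gamma t| <= (`|b - a| / T + `|M|) * `|s - t|.
    move=> st tt.
    have -> : l s - gamma t = (l s - l t1) + (gamma t1 - gamma t).
      by rewrite lt1 -/b addrA subrK.
    apply: (le_trans (ler_normD _ _)); rewrite mulrDl lerD //.
      apply: (le_trans (llip _ _)); rewrite ler_wpM2l // !ler0_norm; lra.
    apply: (le_trans (gM' _ _ t10 (le_trans t10 tt))).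
    by rewrite ler_wpM2l // !ler0_norm; lra.
  move=> s t /= s0 t'0; rewrite /gamma'; case: ltP => hs; case: ltP => ht.
  + by apply: (le_trans (llip _ _)); rewrite ler_wpM2r // lerDl.
  + exact: cross.
  + by rewrite distrC (distrC s); exact: cross.
  + by apply: (le_trans (gM' _ _ s0 t'0)); rewrite ler_wpM2r // lerDr.
exists u'; split.
- move=> i; have -> : (fun t => u' t 0 i) = (fun t => if t < t0 then 0 else
      if t < t1 then (T * h t)^-1 * (b - a) 0 i else u t 0 i).
    apply/funext => t; rewrite /u'; case: ifP => _; first by rewrite mxE.
    by case: ifP => _; [rewrite mxE | reflexivity].
  apply: measurable_if_lt => //; apply: measurable_if_lt => //.
  apply: (@measurable_funS _ _ _ _ setT) => //.
  apply: continuous_measurable_fun => t.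
  apply: cvgM; last exact: cvg_cst.
  apply: cvgV; first by rewrite mulf_neq0 // gt_eqF.
  by apply: cvgM; [exact: cvg_cst | exact: hcont].
- move=> t tge0; rewrite /u'; case: ltP => tt0.
    by rewrite /enorm dotp0r sqrtr0 ler01.
  case: ltP => tt1; last exact: u1.
  have Th : 0 < T * h t by rewrite mulr_gt0.
  rewrite enormZ gtr0_norm ?invr_gt0 // mulrC ler_pdivrMr // mul1r.
  have t0t1 : t0 <= t <= t1 by rewrite tt0 ltW.
  by rewrite /h wE //; exact: (segk t (sig t) t0t1 (sig01 t)).
have ae_neq c : {ae (@lebesgue_measure R), forall t : R, t != c}.
  exists [set c]; split; [exact: measurable_set1|exact: lebesgue_measure_set1|].
  by move=> t /= /negP; rewrite negbK => /eqP.
apply: (@filterS3 _ _ (ae_filter_ringOfSetsType (@lebesgue_measure R)) _ _ _ _ _ du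
  (ae_neq t0) (ae_neq t1)) => t dut tt0 tt1 tge0.
have [tlt0|t0t] := ltP t t0.
  rewrite /u' tlt0 scaler0; apply: (@near_eq_is_derive _ _ _ (cst a)).
    near=> s; rewrite /gamma' lt0 ?if_same //.
      by rewrite (_ : s < t1 = true) //; near: s; apply: lt_nbhsl; exact: lt_trans t01.
    by apply/ltW; near: s; exact: lt_nbhsl.
have {tt0}t0t : t0 < t by rewrite lt_neqAle eq_sym tt0.
have [tlt1|t1t] := ltP t t1.
  rewrite /u' ltNge (ltW t0t) /= tlt1.
  have -> : k t (gamma' t) *: ((T * h t)^-1 *: (b - a)) = T^-1 *: (b - a).
    have kh : k t (gamma' t) = h t by rewrite /gamma' tlt1 /h wE // !ltW.
    by rewrite scalerA kh; congr (_ *: _); field; rewrite !gt_eqF.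
  pose g (s : R) := a + ((s - t0) / T) *: (b - a).
  apply: (@near_eq_is_derive _ _ _ g).
    near=> s; rewrite /gamma' (_ : s < t1 = true); last by near: s; exact: lt_nbhsl.
    rewrite /l /sig wE //; apply/andP; split; apply/ltW; near: s.
      exact: lt_nbhsr.
    exact: lt_nbhsl.
  have gE : g = (fun s : R => (a - (t0 / T) *: (b - a)) + s *: (T^-1 *: (b - a))).
    by apply/funext => s; apply/rowP => i; rewrite !mxE; ring.
  rewrite gE.
  have := @is_derive_line R _ _ id (a - (t0 / T) *: (b - a)) (T^-1 *: (b - a)) t.
  by rewrite diff_val; apply.
have {tt1}t1t : t1 < t by rewrite lt_neqAle eq_sym tt1.
rewrite /u' ltNge (ltW t0t) /= ltNge (ltW t1t) /= /gamma' ltNge (ltW t1t) /=.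
apply: (@near_eq_is_derive _ _ _ gamma); last exact: dut.
by near=> s; rewrite ltNge (_ : t1 <= s) //; apply/ltW; near: s; exact: lt_nbhsr.
Unshelve. all: by end_near.
Qed.

End Detour.

(** * The inward detour *)

(** With [dd] and [nd] standing for [dotp D D] and [dotp n D], the left-hand
side is the squared length of [(1 - th) *: D + eps *: n], the segment to be
run in time [M * eps]; here [th] is [2 / (K * M) ^+ 2] and [kap] is
[(9 * K * M ^+ 2)^-1]. Shortening [D] by the factor [1 - th] gains about
[th * (K * M * eps) ^+ 2 = 2 * eps ^+ 2]: one [eps ^+ 2] pays for the normal
component, the other one for the uncertainty [kap] on the speed and on
[dotp n D]. *)
Lemma detour_length_le (R : realType) (K M eps dd nd : R) : 0 < K -> 1 <= M -> 8 <= K * M -> 0 < eps ->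
  0 <= dd ->
  dd <= (M * eps * (K + (9 * K * M ^+ 2)^-1)) ^+ 2 ->
  nd <= (9 * K * M ^+ 2)^-1 * (M * eps) ->
  (1 - 2 / (K * M) ^+ 2) ^+ 2 * dd + 2 * (1 - 2 / (K * M) ^+ 2) * eps * nd + eps ^+ 2
    <= (M * eps * (K - (9 * K * M ^+ 2)^-1)) ^+ 2.
Proof.
move=> K0 M1 KM eps0 dd0.
set th := 2 / _; set kap := _^-1 => hdd hnd.
have M0 : 0 < M by lra.
have KM2 : 64 <= (K * M) ^+ 2 by nra.
have th0 : 0 <= th by rewrite divr_ge0 // sqr_ge0.
have th1 : th <= 1 by rewrite ler_pdivrMr; lra.
have kap0 : 0 < kap by rewrite invr_gt0; nra.
have thE : th * (K * (M * eps)) ^+ 2 = 2 * eps ^+ 2.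
  by rewrite /th; field; nra.
have kE : 9 * (K * kap * (M * eps) ^+ 2) = eps ^+ 2.
  by rewrite /kap; field; nra.
have h3 : 72 * (eps * (kap * (M * eps))) <= eps ^+ 2.
  rewrite -kE; have : 0 <= (K * M - 8) * (kap * M * eps ^+ 2).
    by rewrite !mulr_ge0 ?sqr_ge0 //; lra.
  by lra.
have h1 : (1 - th) ^+ 2 * dd <= (1 - th) * (M * eps * (K + kap)) ^+ 2.
  apply: ler_pM => //; first by rewrite sqr_ge0.
  by rewrite expr2 ler_piMr; lra.
have h2 : 2 * (1 - th) * eps * nd <= 2 * (eps * (kap * (M * eps))).
  have : (1 - th) * nd <= 1 * (kap * (M * eps)).
    apply: (@le_trans _ _ ((1 - th) * (kap * (M * eps)))); first by rewrite ler_wpM2l //; lra.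
    by rewrite ler_wpM2r //; [rewrite !mulr_ge0 //; lra | lra].
  move=> h; have := ler_wpM2l (ltW eps0) h; lra.
have h4 : th * (K * (M * eps)) ^+ 2 <= th * (M * eps * (K + kap)) ^+ 2.
  have Me : 0 < M * eps by rewrite mulr_gt0.
  have Kk : K <= K + kap by rewrite lerDl ltW.
  apply: ler_wpM2l => //; rewrite [K * _]mulrC; apply: lerXn2r; rewrite ?nnegrE.
  - by rewrite mulr_ge0 // ltW.
  - by rewrite mulr_ge0 ?addr_ge0 // ltW.
  - by rewrite ler_pM2l.
have e2 : 0 <= eps ^+ 2 by rewrite sqr_ge0.
have id1 : (M * eps * (K + kap)) ^+ 2 - (M * eps * (K - kap)) ^+ 2 =
    4 * (K * kap * (M * eps) ^+ 2) by ring.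
by move: h1 h2 h3 h4 thE kE e2 id1; clear; lra.
Qed.

Section InwardDetour.
Context (R : realType) (d : nat).
Implicit Types (Omega : set 'rV[R]_d) (gamma : R -> 'rV[R]_d).

(** Every trajectory issued from [x] can be caught up with, without delay,
by an admissible trajectory issued from a point at distance [O(eps / M)] from
[x - eps *: n]. The threshold on [eps] does not depend on the trajectory, so
that it can be applied to trajectories whose cost is within a multiple of [eps]
of the optimal one. *)
Lemma inward_detour Omega (k : R -> 'rV[R]_d -> R) (Kmin Kmax : R)
    (t0 : R) (x n : 'rV[R]_d) (M : R) : (0 < d)%N ->
  open Omega -> C11_submanifold d.-1 (boundary Omega) -> boundary Omega x ->
  outward_unit_normal Omega x n ->
  {within space_time Omega, continuous (fun z => k z.1 z.2)} ->
  0 < Kmin ->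
  (forall t y, 0 <= t -> closure Omega y -> Kmin <= k t y <= Kmax) ->
  0 <= t0 -> 1 <= M -> 8 <= k t0 x * M ->
  exists2 r, 0 < r & forall (eps : R) gamma, 0 < eps < r ->
    Adm Omega k gamma -> gamma t0 = x ->
    exists gamma', [/\ Adm Omega k gamma',
      enorm (gamma' t0 - (x - eps *: n)) <= 4 * eps / (k t0 x * M) &
      forall t, t0 + M * eps <= t -> gamma' t = gamma t].
Proof.
move=> d0 oO sub Mx on hkc Kmin0 hkb t00 M1 KM8.
have [n1 _ _] := on.
have Ox : closure Omega x by case: Mx.
have kpos t y : 0 <= t -> closure Omega y -> 0 < k t y.
  by move=> t_ge0 Oy; have /andP[+ _] := hkb t y t_ge0 Oy; exact: lt_le_trans.
have K0 := kpos t0 x t00 Ox.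
move: KM8; set K := k t0 x in K0 * => KM8.
have Kmax0 : 0 < Kmax.
  by have /andP[_] := hkb t0 x t00 Ox; apply: lt_le_trans.
have M0 : 0 < M by lra.
pose kap := (9 * K * M ^+ 2)^-1.
have kap0 : 0 < kap by rewrite invr_gt0 !mulr_gt0 ?exprn_gt0.
have kapK : kap <= K.
  rewrite /kap -[leLHS]mul1r ler_pdivrMr ?mulr_gt0 ?exprn_gt0 //.
  have -> : K * (9 * K * M ^+ 2) = 9 * (K * M) ^+ 2 by ring.
  have : 1 <= (K * M) ^+ 2 by rewrite expr_ge1 //; lra.
  by clear; lra.
pose th := 2 / (K * M) ^+ 2.
have th0 : 0 <= th by rewrite divr_ge0 // sqr_ge0.
have [r1 r1_gt0 speed] := speed_within_continuous hkc t00 Ox kap0.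
have ek : 0 < kap / (2 * K) by rewrite divr_gt0 // mulr_gt0.
have [r2 r2_gt0 tangent] := dotp_normal_le d0 oO sub Mx on ek.
pose C := 2 * K * M.
have C0 : 0 < C by rewrite !mulr_gt0.
have [r3 r3_gt0 segment] := inward_segment d0 oO sub Mx on C0.
(* [D * eps] dominates the length of the segment, the distance run by the
   trajectory during the time [M * eps], and this time *)
pose D := C + Kmax * M + M.
have KmM : 0 < Kmax * M by rewrite mulr_gt0.
have D0 : 0 < D by rewrite /D !addr_gt0.
exists (Num.min r1 (Num.min r2 r3) / D).
  by rewrite divr_gt0 // !lt_min r1_gt0 r2_gt0.
move=> eps gamma /andP[eps0]; rewrite ltr_pdivlMr // !lt_min => /and3P[].
rewrite mulrC => D1 D2 D3 gA gx.
have [gO _ _] := gA.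
pose T := M * eps.
have T0 : 0 < T by rewrite mulr_gt0.
have [Ceps KTeps] : 0 < C * eps /\ 0 < Kmax * T by rewrite !mulr_gt0.
have DE : D * eps = C * eps + Kmax * T + T by rewrite /D /T; ring.
rewrite DE in D1 D2 D3.
set b := gamma (t0 + T).
have ge0 t : t0 <= t -> 0 <= t by exact: le_trans.
have kb t : 0 <= t -> 0 <= k t (gamma t) <= Kmax.
  move=> t_ge0; have /andP[h1 h2] := hkb t _ t_ge0 (gO t t_ge0).
  by rewrite h2 andbT (le_trans (ltW Kmin0)).
(* crude bound: the trajectory stays close to x during a time T *)
have close t : t0 <= t <= t0 + T -> enorm (gamma t - x) <= Kmax * T.
  move=> /andP[tt0 tt1]; rewrite -gx.
  apply: (@le_trans _ _ (Kmax * (t - t0))); last by rewrite ler_pM2l // lerBlDl.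
  apply: (Adm_speed gA); first by rewrite t00.
  by move=> s /andP[s0 _]; apply: kb; exact: ge0.
have T_t0 : t0 <= t0 + T by rewrite lerDl ltW.
(* at this scale [k] is within [kap] of [K], which improves the bound *)
have bx : enorm (b - x) <= T * (K + kap).
  have -> : T * (K + kap) = (K + kap) * (t0 + T - t0) by ring.
  rewrite /b -{1}gx.
  apply: (Adm_speed gA); first by rewrite t00.
  move=> t t01; have /andP[tt0 tt1] := t01.
  have t_ge0 := ge0 t tt0.
  have /andP[-> _] := kb t t_ge0; rewrite andTb.
  have : `|k t (gamma t) - K| < kap.
    apply: speed => //; first exact: gO.
      by rewrite ger0_norm ?subr_ge0 //; move: D1 Ceps KTeps tt1; clear; lra.
    apply: (le_lt_trans (normr_le_enorm _)); apply: (le_lt_trans (close t t01)).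
    by move: D1 Ceps T0; clear; lra.
  by rewrite ltr_norml => /andP[_]; clear; lra.
have bxC : enorm (b - x) <= C * eps.
  apply: (le_trans bx); have -> : C * eps = T * (K + K) by rewrite /C /T; ring.
  by rewrite ler_pM2l // lerD2l.
have bxC' := le_trans (normr_le_enorm _) bxC.
have Ob : closure Omega b by apply/gO/ge0.
have nb : dotp n (b - x) <= kap * T.
  have br2 : `|b - x| < r2.
    by apply: (le_lt_trans bxC'); move: D2 KTeps T0; clear; lra.
  apply: (le_trans (tangent b Ob br2)).
  have -> : kap * T = kap / (2 * K) * (C * eps) by rewrite /C /T; field; rewrite gt_eqF.
  by apply: ler_wpM2l => //; exact: ltW.
pose a := x - eps *: n + th *: (b - x).
have thb : th * enorm (b - x) <= 4 * eps / (K * M).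
  apply: (le_trans (ler_wpM2l th0 bxC)).
  by rewrite /th /C le_eqVlt; apply/orP; left; apply/eqP; field; rewrite !gt_eqF.
have small : 4 * eps / (K * M) <= eps / 2.
  rewrite ler_pdivrMr ?mulr_gt0 //; have := ler_wpM2l (ltW eps0) KM8.
  by clear; lra.
have ax : a - x = th *: (b - x) - eps *: n.
  by apply/rowP => i; rewrite !mxE; ring.
have dotnn : dotp n n = 1 by rewrite -enorm_sqr n1 expr1n.
have na : dotp n (a - x) <= - (eps / 2).
  rewrite ax dotpBr !dotpZr dotnn mulr1.
  have : th * dotp n (b - x) <= th * enorm (b - x).
    by rewrite ler_wpM2l // (le_trans (cauchy_schwarz _ _))// n1 mul1r.
  by move: thb small; clear; lra.
have aC : `|a - x| <= C * eps.
  rewrite ax; apply: (le_trans (ler_normB _ _)).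
  rewrite [`|th *: _|]normrZ [`|eps *: _|]normrZ (ger0_norm th0) (gtr0_norm eps0).
  have : th * `|b - x| <= th * enorm (b - x) by rewrite ler_wpM2l // normr_le_enorm.
  have : eps * `|n| <= eps * 1 by rewrite ler_pM2l // -n1 normr_le_enorm.
  have : 16 * eps <= C * eps by rewrite ler_pM2r // /C; move: KM8; clear; lra.
  by move: thb small eps0; clear; lra.
have C3 : C * eps < r3 by move: D3 KTeps T0; clear; lra.
have seg := segment eps a b eps0 C3 aC bxC' na Ob.
have ab : enorm (b - a) <= T * (K - kap).
  have T_ge0 : 0 <= T * (K - kap) by rewrite mulr_ge0 ?subr_ge0 // ltW.
  rewrite -(@ler_pXn2r _ 2) // ?nnegrE ?enorm_ge0 // enorm_sqr.
  have -> : b - a = (1 - th) *: (b - x) + eps *: n.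
    by apply/rowP => i; rewrite !mxE; ring.
  rewrite dotpDl !dotpDr !dotpZl !dotpZr dotnn (dotpC (b - x) n).
  have dd : dotp (b - x) (b - x) <= (T * (K + kap)) ^+ 2.
    rewrite -enorm_sqr lerXn2r ?nnegrE ?enorm_ge0 //.
    exact: le_trans (enorm_ge0 _) bx.
  have := detour_length_le K0 M1 KM8 eps0 (dotpvv_ge0 _) dd nb.
  by rewrite -/kap -/th -/T; apply: le_trans; rewrite le_eqVlt; apply/orP; left; apply/eqP; ring.
have [||gamma' [A' a' tail]] := Adm_detour hkc kpos gA t00 T0 (a := a).
- exact: seg.
- move=> t s /andP[tt0 tt1] s01; apply: (le_trans ab); rewrite ler_pM2l //.
  have t_ge0 := ge0 t tt0.
  have : `|k t (a + s *: (b - a)) - K| < kap.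
    apply: speed => //; first exact: seg.
      by rewrite ger0_norm ?subr_ge0 //; move: D1 Ceps KTeps tt1; clear; lra.
    have C1 : C * eps < r1 by move: D1 KTeps T0; clear; lra.
    by apply: norm_segment_lt => //; exact: le_lt_trans C1.
  by rewrite ltr_norml => /andP[+ _]; rewrite -/b; clear; lra.
exists gamma'; split=> //.
rewrite a'; have -> : a - (x - eps *: n) = th *: (b - x).
  by apply/rowP => i; rewrite !mxE; ring.
by rewrite enormZ ger0_norm.
Qed.

End InwardDetour.

(** * The boundary inequality *)

Lemma value_function_le (R : realType) (d : nat) (Omega Gamma : set 'rV[R]_d)
    (k : R -> 'rV[R]_d -> R) t0 gamma s :
  Adm Omega k gamma -> 0 <= s -> Gamma (gamma (s + t0)) ->
  (value_function Omega Gamma k t0 (gamma t0) <= s%:E)%E.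
Proof.
move=> gA s0 gs; apply: (@le_trans _ _ (tau Gamma t0 gamma)).
  by apply: ereal_inf_lbound; exists gamma.
by apply: ereal_inf_lbound; exists s.
Qed.

Lemma value_function_lt (R : realType) (d : nat) (Omega Gamma : set 'rV[R]_d)
    (k : R -> 'rV[R]_d -> R) t0 x0 (c : R) :
  (value_function Omega Gamma k t0 x0 < c%:E)%E ->
  exists gamma s, [/\ Adm Omega k gamma, gamma t0 = x0, 0 <= s,
    Gamma (gamma (s + t0)) & s < c].
Proof.
move=> /ereal_inf_lt[_ [gamma [gA gx] <-]] /ereal_inf_lt[_ [s [s0 gs] <-]] sc.
by exists gamma, s; split=> //; rewrite lte_fin in sc.
Qed.

Theorem theorem4p11 (R : realType) (d : nat) (hd : (0 < d)%N)
    (Omega Gamma : set 'rV[R]_d)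
    (hOmega0 : Omega !=set0) (hOmegaO : open Omega)
    (hOmegaB : bounded_set Omega) (hOmegaC : connected Omega)
    (hbdK : compact (boundary Omega))
    (hbdM : C11_submanifold d.-1 (boundary Omega))
    (hGamma0 : Gamma !=set0) (hGammaC : closed Gamma)
    (hGammaS : Gamma `<=` closure Omega)
    (k : R -> 'rV[R]_d -> R)
    (hkc : {within space_time Omega, continuous (fun z => k z.1 z.2)})
    (Kmin Kmax : R) (hKmin : 0 < Kmin) (hKmax : 0 < Kmax)
    (hkb : forall t x, 0 <= t -> closure Omega x -> Kmin <= k t x <= Kmax)
    (L : R) (hL : 0 < L)
    (hkL : forall t x1 x2, 0 <= t -> closure Omega x1 -> closure Omega x2 ->
       `|k t x1 - k t x2| <= L * enorm (x1 - x2)) :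
  forall (t : R) (x : 'rV[R]_d),
    0 <= t -> (boundary Omega `\` Gamma) x ->
    forall n : 'rV[R]_d, outward_unit_normal Omega x n ->
      visc_super_normal_derivative_ge0 Omega (value_function Omega Gamma k) t x n.
Proof.
move=> t x t0 [Mx nGx] n on V W xi VS nV oW VW [dxi _] xix below.
have [n1 _ _] := on.
have Ox : closure Omega x by case: Mx.
set p := grad_x xi t x.
rewrite leNgt; apply/negP => pn_lt0.
pose delta := - dotp p n.
have delta0 : 0 < delta by rewrite oppr_gt0.
have K0 : 0 < k t x by have /andP[+ _] := hkb t x t0 Ox; apply: lt_le_trans.
pose P := enorm p.
have P0 : 0 <= P by exact: enorm_ge0.
have Kd : 0 < k t x * delta by rewrite mulr_gt0.
(* [M] is such that [8 <= K * M], and that the product of [p] with a vector of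
   norm at most [4 * eps / (K * M)] is at most [eps * delta / 4], for [K = k t x] *)
pose M := 1 + 8 / k t x + 16 * P / (k t x * delta).
have M8 : 0 <= 8 / k t x by rewrite divr_ge0 // ltW.
have M16 : 0 <= 16 * P / (k t x * delta) by rewrite divr_ge0 ?mulr_ge0 // ltW.
have M1 : 1 <= M by rewrite /M -addrA lerDl addr_ge0.
have KM8 : 8 <= k t x * M.
  rewrite mulrC -ler_pdivrMr // /M; move: M16; clear; lra.
have KMP : 16 * P <= k t x * M * delta.
  have -> : k t x * M * delta = M * (k t x * delta) by ring.
  rewrite -ler_pdivrMr // /M; move: M8; clear; lra.
have KM0 : 0 < k t x * M by move: KM8; clear; lra.
have [r1 r1_gt0 detour] := inward_detour hd hOmegaO hbdM Mx on hkc hKmin hkb t0 M1 KM8.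
have [r2 r2_gt0 nbhsV] : exists2 r, 0 < r & forall y, closure Omega y ->
    `|y - x| < r -> V (t, y).
  move: nV => /nbhs_ballP[r /= r0 Hr]; exists r => // y Oy yr.
  apply: Hr => //; split; rewrite /= -ball_normE /=; first by rewrite subrr normr0.
  by rewrite distrC.
have Vtx : V (t, x) by apply: nbhsV => //; rewrite subrr normr0.
have d16 : 0 < delta / 16 by rewrite divr_gt0.
have [r3 r3_gt0 expansion] := grad_x_expansion (dxi _ (VW _ Vtx)) d16.
have [r4 r4_gt0 farGamma] : exists2 r, 0 < r & forall y, `|y - x| < r -> ~ Gamma y.
  have : nbhs x (~` Gamma) by apply: open_nbhs_nbhs; split=> //; exact: closed_openC.
  move=> /nbhs_ballP[r /= r0 Hr]; exists r => // y yr.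
  by apply: Hr; rewrite -ball_normE /= distrC.
have KmM : 0 < Kmax * M by rewrite mulr_gt0 //; move: M1; clear; lra.
pose m := Num.min (Num.min r1 r2) (Num.min r3 r4).
have m0 : 0 < m by rewrite !lt_min r1_gt0 r2_gt0 r3_gt0 r4_gt0.
pose D := 3 + Kmax * M.
have D0 : 0 < D by rewrite addr_gt0.
(* [eps] is below all thresholds even when multiplied by [3] or by [Kmax * M] *)
pose eps := m / (2 * D).
have eps0 : 0 < eps by rewrite divr_gt0 // mulr_gt0.
have : D * eps < m.
  have -> : D * eps = m / 2 by rewrite /eps; field; rewrite gt_eqF.
  by move: m0; clear; lra.
have -> : D * eps = 3 * eps + Kmax * M * eps by rewrite /D; ring.
have KmMe : 0 < Kmax * M * eps by rewrite mulr_gt0.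
rewrite !lt_min => /andP[/andP[e1 e2] /andP[e3 e4]].
(* a trajectory which is optimal up to a fraction of [eps] *)
have [gamma [s [gA gx s0 gs s_lt]]] : exists gamma s, [/\ Adm Omega k gamma,
    gamma t = x, 0 <= s, Gamma (gamma (s + t)) & s < xi (t, x) + eps * delta / 4].
  apply: value_function_lt; rewrite -xix lte_fin ltrDl.
  by rewrite divr_gt0 // mulr_gt0.
(* the target is not reached before the detour is over *)
have sT : M * eps <= s.
  rewrite leNgt; apply/negP => sT; apply: (farGamma (gamma (s + t))) => //.
  apply: (le_lt_trans (normr_le_enorm _)).
  apply: (@le_lt_trans _ _ (Kmax * s)).
    rewrite -{1}gx -[s in leRHS](addrK t).
    apply: (Adm_speed gA); first by rewrite t0 lerDr.
    move=> r /andP[tr _]; have r_ge0 := le_trans t0 tr; have [gO _ _] := gA.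
    have /andP[h1 ->] := hkb r _ r_ge0 (gO r r_ge0).
    by rewrite andbT (le_trans (ltW hKmin)).
  have : Kmax * s < Kmax * (M * eps) by rewrite ltr_pM2l.
  by move: e4 eps0; clear; lra.
have eps_r1 : 0 < eps < r1 by rewrite eps0 /=; move: e1 eps0 KmMe; clear; lra.
have [gamma' [gA' a_close tail]] := detour eps gamma eps_r1 gA gx.
set a := gamma' t in a_close.
have Oa : closure Omega a by case: gA' => + _ _; apply.
have value_a : (value_function Omega Gamma k t a <= s%:E)%E.
  apply: (value_function_le gA' s0); rewrite tail //.
  by rewrite addrC lerD2r.
set w := a - (x - eps *: n) in a_close.
have small : 4 * eps / (k t x * M) <= eps / 2.
  rewrite ler_pdivrMr //; have := ler_wpM2l (ltW eps0) KM8; clear; lra.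
have ax : a - x = w - eps *: n by apply/rowP => i; rewrite !mxE; ring.
have ax_le : `|a - x| <= 2 * eps.
  rewrite ax; apply: (le_trans (ler_normB _ _)).
  have : `|w| <= eps / 2 by apply: (le_trans (normr_le_enorm _)); exact: le_trans small.
  have : `|eps *: n| <= eps.
    by rewrite normrZ gtr0_norm // ger_pMr // -n1 normr_le_enorm.
  by move: eps0; clear; lra.
have pw : - (eps * delta / 4) <= dotp p w.
  have h : P * enorm w <= eps * delta / 4.
    apply: (le_trans (ler_wpM2l P0 a_close)).
    rewrite mulrA ler_pdivrMr //; have := ler_wpM2l (ltW eps0) KMP; clear; lra.
  have := normr_dotp_le p w; rewrite ler_norml => /andP[+ _].
  by move: h; rewrite -/P; clear; lra.
have Va : V (t, a).
  by apply: nbhsV => //; apply: (le_lt_trans ax_le); move: e2 eps0 KmMe; clear; lra.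
have : (xi (t, a) <= s).
  by rewrite -lee_fin; apply: (le_trans (below _ Va)).
have ar3 : `|a - x| < r3.
  by apply: (le_lt_trans ax_le); move: e3 eps0 KmMe; clear; lra.
have := expansion a ar3; rewrite -/p ax dotpBr dotpZr -ax.
have := ler_wpM2l (ltW d16) ax_le.
rewrite ler_norml => h1 /andP[h2 _] h3.
have ed : 0 < eps * delta by rewrite mulr_gt0.
have edE : eps * dotp p n = - (eps * delta) by rewrite /delta mulrN opprK.
by move: h1 h2 h3 pw s_lt ed edE; clear; lra.
Qed.
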